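(* For any finite set $X$ endowed with a set of partial bijections $\tilde A$ and every positive integer $n$, there exists a finite $A$-generated group $G$ such that for every choice of elements $g_1,\dots,g_n\in G$ there exist $f_1,\dots,f_n\in F$ for which the set of pairs \[\{(xg_i,xf_i)\colon x\in X,\ i=1,\dots,n\}\] is a partial function $X_{\mathcal{P}}G\to X_{\mathcal{P}}F$.
   Context: $\tilde A=A\cup A^{-1}$ is a set of partial bijections of $X$ closed under inversion, acting on the right, $x\mapsto x\cdot a$. The elements of $A$ also serve as abstract symbols, in which case $A^{-1}$ is a disjoint set of formal inverses. $\mathcal{P}$ is the $A$-labelled graph with vertex set $X$ and an edge $x_1\to x_2$ labelled $a\in\tilde A$ whenever $x_1\cdot a=x_2$. An $A$-generated group is a group $G$ with a map $A\to G$ (not necessarily injective) whose image generates $G$; $[a]_G$ is the value of $a\in\tilde A$. $F$ is the free group on $A$. For an $A$-generated group $G$ let $\Theta(\mathcal{P})$ be the smallest equivalence relation on $X\times G$ that is compatible with all operations $(x,g)\mapsto(x,g[a]_G)$, $a\in\tilde A$, and contains all pairs $((x_1,[a]_G),(x_2,1_G))$ with $a\in\tilde A$ and $x_1\cdot a=x_2$. Then $X_{\mathcal{P}}G=(X\times G)/\Theta(\mathcal{P})$, and $xg$ denotes the class of $(x,g)$. A set of pairs is a partial function if pairs with equal first entries have equal second entries; i.e. here: for all $x,y\in X$ and $i,j$, $xg_i=yg_j$ in $X_{\mathcal{P}}G$ implies $xf_i=yf_j$ in $X_{\mathcal{P}}F$. *)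

(* Defs.v *)
From HB Require Import structures.
From mathcomp Require Import all_boot all_fingroup.
From mathcomp Require Import generic_quotient boolp.

Set Implicit Arguments.
Unset Strict Implicit.
Unset Printing Implicit Defensive.

Local Open Scope quotient_scope.
Local Open Scope group_scope.

Section FreeGroup.
Variable A : choiceType.

(* (a, false) is the symbol a and (a, true) its formal inverse *)
Definition letter := (A * bool)%type.
Definition linv (l : letter) : letter := (l.1, ~~ l.2).

Definition reduced (w : seq letter) := sorted (fun l m => m != linv l) w.

Definition push (l : letter) (w : seq letter) :=
  if w is m :: w' then if m == linv l then w' else l :: w else [:: l].

Definition reduce (w : seq letter) := foldr push [::] w.

Lemma linvK : involutive linv.
Proof. by case=> a b; rewrite /linv /= negbK. Qed.

Lemma linv_neq l : linv l != l.
Proof. by case: l => a b; rewrite /linv xpair_eqE /= eqxx; case: b. Qed.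

Lemma push_reduced l w : reduced w -> reduced (push l w).
Proof.
case: w => //= m w w_red; case: ifP => [_|/negbT ml] /=.
  exact: path_sorted w_red.
by rewrite ml.
Qed.

Lemma pushK l w : reduced w -> push (linv l) (push l w) = w.
Proof.
case: w => [_|m w] /=; first by rewrite linvK eqxx.
case: (m =P linv l) => [-> w_red|_ _] /=; last by rewrite linvK eqxx.
case: w w_red => //= k w /andP[kl _].
by rewrite (negbTE kl).
Qed.

Lemma push_id l w : reduced (l :: w) -> push l w = l :: w.
Proof. by case: w => //= m w /andP[/negbTE -> _]. Qed.

Lemma foldr_push_reduced u r : reduced r -> reduced (foldr push r u).
Proof. by move=> r_red; elim: u => //= l u; apply: push_reduced. Qed.

Lemma reduce_reduced w : reduced (reduce w).
Proof. exact: foldr_push_reduced. Qed.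

Lemma reduce_id w : reduced w -> reduce w = w.
Proof.
elim: w => //= l w IHw w_red.
by rewrite -/(reduce w) IHw ?push_id //; apply: path_sorted w_red.
Qed.

Lemma foldr_push_push l w r : reduced r ->
  foldr push r (push l w) = push l (foldr push r w).
Proof.
move=> r_red; case: w => //= m w; case: eqP => //= ->.
by rewrite -{1}[l]linvK pushK // foldr_push_reduced.
Qed.

Lemma foldr_push_reduce w r : reduced r ->
  foldr push r (reduce w) = foldr push r w.
Proof.
by move=> r_red; elim: w => //= l w IHw; rewrite foldr_push_push ?IHw.
Qed.

Lemma reduce_cat u v : reduce (u ++ v) = foldr push (reduce v) u.
Proof. by rewrite /reduce foldr_cat. Qed.

Lemma reduce_catl u v : reduce (reduce u ++ v) = reduce (u ++ v).
Proof. by rewrite !reduce_cat foldr_push_reduce // reduce_reduced. Qed.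

Lemma reduce_catr u v : reduce (u ++ reduce v) = reduce (u ++ v).
Proof. by rewrite !reduce_cat (reduce_id (reduce_reduced v)). Qed.

Lemma reduce_catV w : reduce (rev (map linv w) ++ w) = [::].
Proof.
elim: w => //= l w IHw.
rewrite rev_cons cat_rcons reduce_cat /= -/(reduce w).
by rewrite pushK ?reduce_reduced // -reduce_cat.
Qed.

Lemma reduce_Vcat w : reduce (w ++ rev (map linv w)) = [::].
Proof.
rewrite -[w in w ++ _](mapK linvK) -[X in X ++ _]revK -map_rev.
exact: reduce_catV.
Qed.

Record freeGroup := FreeGroup {
  fword :> seq letter;
  fword_reduced : reduced fword }.

HB.instance Definition _ := [isSub for fword].
HB.instance Definition _ := [Choice of freeGroup by <:].

Definition fg_of (w : seq letter) := FreeGroup (reduce_reduced w).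
Definition fg_mul (u v : freeGroup) := fg_of (fword u ++ fword v).
Definition fg_one := fg_of [::].
Definition fg_inv (u : freeGroup) := fg_of (rev (map linv u)).

Lemma fg_mulA : associative fg_mul.
Proof.
by move=> u v w; apply: val_inj; rewrite /= reduce_catr reduce_catl catA.
Qed.

Lemma fg_mul1 : left_id fg_one fg_mul.
Proof. by move=> u; apply: val_inj => /=; apply/reduce_id/fword_reduced. Qed.

Lemma fg_mulr1 : right_id fg_one fg_mul.
Proof.
by move=> u; apply: val_inj => /=; rewrite cats0; apply/reduce_id/fword_reduced.
Qed.

Lemma fg_mulV : left_inverse fg_one fg_inv fg_mul.
Proof.
by move=> u; apply: val_inj; rewrite /= reduce_catl reduce_catV.
Qed.

Lemma fg_mulrV : right_inverse fg_one fg_inv fg_mul.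
Proof.
by move=> u; apply: val_inj; rewrite /= reduce_catr reduce_Vcat.
Qed.

HB.instance Definition _ :=
  isGroup.Build freeGroup fg_mulA fg_mul1 fg_mulr1 fg_mulV fg_mulrV.

Definition fgen (a : A) : freeGroup := fg_of [:: (a, false)].

End FreeGroup.

(* The value of a letter in a group G equipped with a map v : A -> G. *)
Definition lval (A : choiceType) (G : groupType) (v : A -> G) (l : letter A) : G :=
  if l.2 then (v l.1)^-1 else v l.1.

Section FreeGroupUniversal.
Variables (A : choiceType) (G : groupType) (v : A -> G).

Definition flift (u : freeGroup A) : G := \prod_(l <- fword u) lval v l.

Lemma lval_linv l : lval v (linv l) = (lval v l)^-1.
Proof. by case: l => a []; rewrite /lval //= invgK. Qed.

Lemma prod_reduce w :
  \prod_(l <- reduce w) lval v l = \prod_(l <- w) lval v l.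
Proof.
elim: w => //= l w IHw; rewrite big_cons -IHw -/(reduce w).
case: (reduce w) => [|m r] /=; first by rewrite big_cons.
case: eqP => [->|_]; last by rewrite big_cons.
by rewrite big_cons lval_linv mulKVg.
Qed.

Lemma flift_mul : {morph flift : u w / u * w}.
Proof. by move=> u w; rewrite /flift prod_reduce big_cat. Qed.

Lemma flift_fgen a : flift (fgen a) = v a.
Proof. by rewrite /flift big_cons big_nil mulg1. Qed.

Lemma fg_word (u : freeGroup A) : u = \prod_(l <- fword u) lval (@fgen A) l.
Proof.
have lvalE l : lval (@fgen A) l = fg_of [:: l].
  by case: l => a []; apply: val_inj.
apply: val_inj; rewrite -[LHS](reduce_id (fword_reduced u)).
elim: (fword u) => [|l w IHw]; first by rewrite big_nil.
by rewrite big_cons lvalE -[RHS]/(reduce ([:: l] ++ _)) -IHw reduce_catr.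
Qed.

Lemma flift_unique (h : freeGroup A -> G) :
  {morph h : u w / u * w} -> (forall a, h (fgen a) = v a) -> h =1 flift.
Proof.
move=> hM hv u.
have h1 : h 1 = 1 by apply: (mulgI (h 1)); rewrite -hM !mulg1.
have hV w : h w^-1 = (h w)^-1.
  by apply: (mulgI (h w)); rewrite -hM !mulgV h1.
rewrite {1}(fg_word u) (big_morph h hM h1) /flift.
by apply: eq_bigr => -[a []] _; rewrite /lval /= ?hV hv.
Qed.

End FreeGroupUniversal.

(* f x = Some y means that f is defined at x with value y. *)
Definition pinjective (X : finType) (f : {ffun X -> option X}) :=
  [forall x, forall y, (f x == f y) && (f x != None) ==> (x == y)].

Definition pbij (X : finType) := {f : {ffun X -> option X} | pinjective f}.

Section XP.
Variables (X : finType) (A : {set pbij X}).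

(* The elements of A as abstract symbols. *)
Definition symbol := {a : pbij X | a \in A}.

Definition papply (a : symbol) (x : X) : option X := val (val a) x.

Definition edge (l : letter symbol) (x y : X) : bool :=
  if l.2 then papply l.1 y == Some x else papply l.1 x == Some y.

Variables (G : groupType) (v : symbol -> G).

Inductive Theta : X * G -> X * G -> Prop :=
| Theta_refl p : Theta p p
| Theta_sym p q : Theta p q -> Theta q p
| Theta_trans p q r : Theta p q -> Theta q r -> Theta p r
| Theta_mul x y g h l : Theta (x, g) (y, h) ->
    Theta (x, g * lval v l) (y, h * lval v l)
| Theta_edge l x y : edge l x y -> Theta (x, lval v l) (y, 1).

Definition thetab (p q : X * G) : bool := `[< Theta p q >].

Lemma thetab_refl : reflexive thetab.
Proof. by move=> p; apply/asboolP/Theta_refl. Qed.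

Lemma thetab_sym : symmetric thetab.
Proof. by move=> p q; apply/asboolP/asboolP; apply: Theta_sym. Qed.

Lemma thetab_trans : transitive thetab.
Proof.
move=> q p r /asboolP pq /asboolP qr; apply/asboolP; exact: Theta_trans pq qr.
Qed.

Canonical theta_equiv := EquivRel thetab thetab_refl thetab_sym thetab_trans.

Definition XP := {eq_quot theta_equiv}.

Definition xp (x : X) (g : G) : XP := \pi_({eq_quot theta_equiv}) (x, g).

Lemma xp_eq x g y h : xp x g = xp y h <-> Theta (x, g) (y, h).
Proof. by split=> [/eqmodP/asboolP|H] //; apply/eqmodP/asboolP. Qed.

End XP.

Arguments xp {X A G} v x g.

Definition partial_function (S T : Type) (P : S * T -> Prop) :=
  forall p q, P p -> P q -> p.1 = q.1 -> p.2 = q.2.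

(* Main.v *)
Require Import Defs.
From mathcomp Require Import all_boot all_fingroup.
From mathcomp Require Import boolp.

Set Implicit Arguments.
Unset Strict Implicit.
Unset Printing Implicit Defensive.

Local Open Scope group_scope.

(* Following a letter with the second coordinate inverted, X_P G is the set of
   connected components ("cosets") of the product of the partial automaton X
   with the Cayley graph of G, and [x g = y h] says that the vertices g^-1 and
   h^-1 lie on a common coset in states x and y. Finite complete automata Y
   serve in place of Cayley graphs. Let Y' be the automaton which also records
   the parity of the number of crossings of each edge of Y. Two paths in Y'
   with the same ends cross the same edges of Y an odd number of times, so these
   edges lie in the intersection of the images in Y of all cosets through both
   ends. Given finitely many cosets over Y' such that no subfamily with a common
   vertex in Y loses it in Y', this makes the family Helly and lets it be cut
   along cliques down to subfamilies with a common vertex, and the pieces glue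
   together in the free group. Iterating the construction often enough, two
   consecutive levels must have the same intersecting subfamilies. *)

(** A permutation agreeing with [f] at as many points as possible extends it: were [s x] different
    from [f x = Some y], composing with the transposition of [s x] and [y] would gain the point [x]
    and, by injectivity, lose none. *)
Lemma pinj_extends_perm (X : finType) (f : {ffun X -> option X}) :
  pinjective f -> exists s : {perm X}, forall x y, f x = Some y -> s x = y.
Proof.
move=> f_inj; pose agree (s : {perm X}) := [set x | f x == Some (s x)].
case: (@arg_maxnP _ 1%g xpredT (fun s => #|agree s|) isT) => s _ s_max.
exists s => x y fx; apply/eqP/negPn/negP => sx_y.
pose s' := s * tperm (s x) y.
suff: agree s \proper agree s'.
  by move/proper_card; rewrite ltnNge => /negP[]; apply: s_max.
apply/properP; split; last first.
  by exists x; rewrite inE fx ?permM ?tpermL // (inj_eq Some_inj) eq_sym.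
apply/subsetP => z; rewrite !inE permM => /eqP fz; rewrite fz; apply/eqP.
congr Some; rewrite tpermD //.
  apply/eqP => /perm_inj xz; move: fz sx_y; rewrite -xz fx => -[->].
  by rewrite eqxx.
apply/eqP => y_sz; have xz : x = z.
  apply/eqP; move/forallP/(_ x)/forallP/(_ z)/implyP: f_inj; apply.
  by rewrite fx fz y_sz eqxx.
by move: sx_y; rewrite y_sz xz eqxx.
Qed.

(** * Complete automata and the cosets of X over them *)

Section Automata.
Variables (X : finType) (A : {set pbij X}).

Lemma edge_linv (l : letter (symbol A)) x y : edge (linv l) y x = edge l x y.
Proof. by case: l => a []. Qed.

Record automaton := Automaton {
  vertex :> finType;
  act : letter (symbol A) -> vertex -> vertex;
  actK : forall l, cancel (act l) (act (linv l)) }.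

Section Cosets.
Variable Y : automaton.
Implicit Types (p q : X * Y) (x : X) (y : Y).

Definition step p q :=
  [exists l : letter (symbol A), edge l p.1 q.1 && (act l p.2 == q.2)].

Definition conn := connect step.

Lemma conn_sym p q : conn p q = conn q p.
Proof.
apply: sym_connect_sym => {}p {}q.
apply/existsP/existsP => -[l /andP[e /eqP E]];
  by exists (linv l); rewrite edge_linv e -E actK eqxx.
Qed.

Lemma conn_ind (P : X * Y -> X * Y -> Prop) :
  (forall p, P p p) ->
  (forall p q r l, edge l p.1 q.1 -> act l p.2 = q.2 -> conn q r ->
    P q r -> P p r) ->
  forall p q, conn p q -> P p q.
Proof.
move=> P0 PS p q /connectP[s]; elim: s p => [|r s IH] p /=.
  by move=> _ ->.
case/andP=> /existsP[l /andP[e /eqP E]] rs qE.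
by apply: (PS _ _ _ _ e E); [apply/connectP; exists s|apply: IH].
Qed.

Definition on p y := [exists x, conn p (x, y)].

Definition on_edge p (e : Y * symbol A) :=
  [exists x, conn p (x, e.1) && (papply e.2 x != None)].

Definition target (e : Y * symbol A) := act (e.2, false) e.1.

Definition faithful := forall x x' y, conn (x, y) (x', y) -> x = x'.

Lemma on_edgeP p e : reflect
  (exists x x', [/\ conn p (x, e.1), conn p (x', target e) &
                    edge (e.2, false) x x'])
  (on_edge p e).
Proof.
apply: (iffP existsP) => [[x /andP[px]]|[x [x' [px _ ex]]]]; last first.
  by exists x; rewrite px (eqP ex).
case E: (papply e.2 x) => [x'|] // _.
have ex : edge (e.2, false) x x' by apply/eqP.
exists x, x'; split=> //; apply: connect_trans px (connect1 _).
by apply/existsP; exists (e.2, false); rewrite ex eqxx.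
Qed.

Lemma on_edge_source p e : on_edge p e -> on p e.1.
Proof. by case/on_edgeP=> x [x' [px _ _]]; apply/existsP; exists x. Qed.

Lemma on_edge_target p e : on_edge p e -> on p (target e).
Proof. by case/on_edgeP=> x [x' [_ px _]]; apply/existsP; exists x'. Qed.

Lemma faithful_state p x x' y : faithful ->
  conn p (x, y) -> conn p (x', y) -> x = x'.
Proof.
move=> fY px px'; apply: (fY _ _ y).
by apply: connect_trans px'; rewrite -/conn conn_sym.
Qed.

End Cosets.

(** * The parity unfolding of an automaton *)

Section Unfold.
Variable Y : automaton.

(** Edges are named by their source under a positive letter, so an inverse letter crosses the edge
    that starts at the vertex it reaches. *)
Definition crossed (l : letter (symbol A)) (y : Y) :=
  (if l.2 then act l y else y, l.1).

Definition unfold_vertex := (Y * {ffun Y * symbol A -> bool})%type.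

Definition unfold_act l (y : unfold_vertex) : unfold_vertex :=
  (act l y.1, [ffun e => y.2 e (+) (e == crossed l y.1)]).

Lemma unfold_actK l : cancel (unfold_act l) (unfold_act (linv l)).
Proof.
move=> [y c]; congr pair; first exact: actK.
apply/ffunP => e; rewrite !ffunE /=.
suff -> : crossed (linv l) (act l y) = crossed l y.
  by rewrite -addbA addbb addbF.
by case: l => a [] //; congr pair; apply: (actK (a, false)).
Qed.

Definition unfolding := Automaton unfold_actK.

Definition proj (p : X * unfolding) : X * Y := (p.1, p.2.1).

(** When a path leads from [y] to [z], these are the edges that it crosses an odd number of times,
    whichever path is taken. *)
Definition diff (y z : unfolding) (e : Y * symbol A) := y.2 e (+) z.2 e.

Lemma diff_trans (y z t : unfolding) e : diff y t e -> diff y z e || diff z t e.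
Proof. by rewrite /diff; case: (y.2 e) (z.2 e) (t.2 e) => [] [] []. Qed.

Lemma conn_proj p q : conn p q -> conn (proj p) (proj q).
Proof.
elim/conn_ind => [{}p|{}p r {}q l e E _ IH]; first exact: connect0.
apply: connect_trans IH; apply: connect1; apply/existsP; exists l.
by rewrite /= e -E eqxx.
Qed.

Lemma on_proj p y : on p y -> on (proj p) y.1.
Proof.
by case/existsP=> x px; apply/existsP; exists x; apply: (conn_proj px).
Qed.

Lemma unfold_faithful : faithful Y -> faithful unfolding.
Proof. by move=> fY x x' y /conn_proj; apply: fY. Qed.

Lemma diff_on_edge p q e :
  conn p q -> diff p.2 q.2 e -> on_edge (proj p) e.
Proof.
elim/conn_ind=> [{}p|{}p r {}q l el E rq IH]; first by rewrite /diff addbb.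
have pr : conn (proj p) (proj r).
  by apply/conn_proj/connect1/existsP; exists l; rewrite el E eqxx.
move/(diff_trans r.2) => /orP[|/IH/existsP[x /andP[rx xe]]]; last first.
  by apply/existsP; exists x; rewrite xe andbT; apply: connect_trans rx.
rewrite /diff -E ffunE addbA addbb addFb => /eqP ->; apply/existsP.
move: el pr; rewrite /proj -E /crossed /edge.
case: l E => a [] E /= /eqP el pr.
  by exists r.1; rewrite pr el.
by exists p.1; rewrite el andbT; apply: connect0.
Qed.

Lemma diff_on p y z e :
  on p y -> on p z -> diff y z e -> on_edge (proj p) e.
Proof.
case/existsP=> x py /existsP[x' pz] yze.
have yz : conn (x, y) (x', z).
  by apply: connect_trans pz; rewrite -/(conn _ _) conn_sym.
have /existsP[x1 /andP[h1 h2]] := diff_on_edge yz yze.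
apply/existsP; exists x1; rewrite h2 andbT.
exact: connect_trans (conn_proj py) h1.
Qed.

(* The parity of [D y] plus the number of crossings of the boundary of D does
   not change along a path, so a path whose oddly crossed edges avoid the
   boundary of D cannot leave D. *)
Lemma cut_invariant (D : pred Y) p q : conn p q ->
  (forall e, diff p.2 q.2 e -> D e.1 = D (target e)) -> D p.2.1 = D q.2.1.
Proof.
pose cut e := D e.1 (+) D (target e).
pose phi (y : unfolding) := D y.1 (+) \big[addb/false]_e (y.2 e && cut e).
move=> pq clD; have: phi p.2 = phi q.2.
  elim/conn_ind: pq {clD} => // {}p r {}q l _ <- _ <-.
  rewrite /phi /= [in RHS](eq_bigr (fun e =>
    (p.2.2 e && cut e) (+) ((e == crossed l p.2.1) && cut e))); last first.
    by move=> e _; rewrite ffunE andb_addl.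
  rewrite big_split /= [X in _ (+) (_ (+) X)](bigD1 (crossed l p.2.1)) //=.
  rewrite eqxx /= [X in cut _ (+) X]big1 ?addbF; last first.
    by move=> e ne; rewrite (negbTE ne).
  have -> : cut (crossed l p.2.1) = D p.2.1 (+) D (act l p.2.1).
    rewrite /cut /target /crossed; case: l => a [] //=.
    by rewrite (actK (a, true) p.2.1 : act (a, false) _ = _) addbC.
  by case: (D _) (D _) (bigop.body _ _ _) => [] [] [].
rewrite /phi; suff -> : \big[addb/false]_e (p.2.2 e && cut e) =
    \big[addb/false]_e (q.2.2 e && cut e) by move/addIb.
apply: eq_bigr => e _; rewrite /cut.
by case E: (diff p.2 q.2 e); move: (clD e) E; rewrite /diff;
   case: (p.2.2 e) (q.2.2 e) => [] [] //= -> //; rewrite addbb.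
Qed.

End Unfold.

(** * Finite families of cosets and their lifts to the free group *)

Section Patterns.
Variable T : finType.

Definition joint (Y : automaton) (p : T -> X * Y) (S : {set T}) :=
  [exists y, [forall s in S, on (p s) y]].

Lemma jointP (Y : automaton) (p : T -> X * Y) (S : {set T}) :
  reflect (exists y, forall s, s \in S -> on (p s) y) (joint p S).
Proof.
apply: (iffP existsP) => -[y h]; exists y; first exact/forall_inP.
exact/forall_inP.
Qed.

Lemma joint_sub (Y : automaton) (p : T -> X * Y) (S S' : {set T}) :
  S \subset S' -> joint p S' -> joint p S.
Proof.
by move=> /subsetP sS /jointP[y h]; apply/jointP; exists y => s /sS /h.
Qed.

Lemma joint1 (Y : automaton) (p : T -> X * Y) s : joint p [set s].
Proof.
apply/jointP; exists (p s).2 => _ /set1P ->; apply/existsP; exists (p s).1.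
by rewrite -surjective_pairing; apply: connect0.
Qed.

Lemma joint_proj (Y : automaton) (p : T -> X * unfolding Y) :
  forall S, joint p S -> joint (@proj Y \o p) S.
Proof.
move=> S /jointP[y h]; apply/jointP; exists y.1 => s /h.
exact: on_proj.
Qed.

Local Notation F := (freeGroup (symbol A)).
Local Notation ThetaF := (Theta (@fgen (symbol A))).

(** [q s] represents the class of X_P F assigned to the coset of [p s]. That [f] depends on the
    vertex alone lets a single [f] serve all cosets through [y]. *)
Definition solvable_on (Y : automaton) (p : T -> X * Y) (U : {set T}) :=
  exists q : T -> X * F, forall y, exists f : F, forall s x,
    s \in U -> conn (p s) (x, y) -> ThetaF (q s) (x, f).

Lemma ThetaF_mulr x y (g h f : F) :
  ThetaF (x, g) (y, h) -> ThetaF (x, g * f) (y, h * f).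
Proof.
move=> xy; rewrite (fg_word f) /=; elim: (fword f) g h xy => [|l w IH] g h xy.
  by rewrite big_nil !mulg1.
by rewrite big_cons !mulgA; apply: IH; apply: Theta_mul.
Qed.

Lemma ThetaF_edge l x y (g : F) :
  edge l x y -> ThetaF (x, lval (@fgen (symbol A)) l * g) (y, g).
Proof.
move=> e; rewrite -{2}[g]mul1g; apply: ThetaF_mulr; exact: Theta_edge.
Qed.

Lemma solvable_proj (Y : automaton) (p : T -> X * unfolding Y) U :
  solvable_on (@proj Y \o p) U -> solvable_on p U.
Proof.
case=> q hq; exists q => y; have [f hf] := hq y.1; exists f => s x sU px.
by apply: hf => //; apply: (conn_proj px).
Qed.

(** * Stable families: Helly property, gluing and solvability *)

Section Stable.
Variables (Y : automaton) (fY : faithful Y) (p : T -> X * unfolding Y).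
Hypothesis stable : forall S, joint (@proj Y \o p) S -> joint p S.

(* If the cosets of a and b had over Y no common vertex lying on all cosets of
   S, then no edge crossed oddly between y and z would leave the coset of b. *)
Lemma bridge (S : {set T}) a b c (y z : unfolding Y) : c \in S ->
  (forall s, s \in S -> on (p s) y /\ on (p s) z) ->
  on (p b) y -> on (p a) z ->
  (forall e, diff y z e -> on_edge (proj (p c)) e ->
     on_edge (proj (p a)) e || on_edge (proj (p b)) e) ->
  joint p (a |: (b |: S)).
Proof.
move=> cS hS yb za hab; apply: stable.
pose inS (y0 : Y) := [forall s in S, on (proj (p s)) y0].
case: (boolP [exists y0, inS y0 && on (proj (p a)) y0 && on (proj (p b)) y0]).
  case/existsP=> y0 /andP[/andP[/forall_inP hy0 ha] hb]; apply/jointP.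
  by exists y0 => s /setU1P[->|/setU1P[->|/hy0]].
move/existsPn => no; case/negP: (no z.1).
have inSz : inS z.1 by apply/forall_inP => s /hS[_ /on_proj].
rewrite inSz (on_proj za) /=.
have [/existsP[x cy] /existsP[x' cz]] := hS _ cS.
have yz : conn (x, y) (x', z).
  by apply: connect_trans cz; rewrite -/(conn _ _) conn_sym.
rewrite -(cut_invariant (D := on (proj (p b))) yz) ?(on_proj yb) //.
move=> e /= yze; have heS s : s \in S -> on_edge (proj (p s)) e.
  by move=> sS; have [sy sz] := hS _ sS; apply: diff_on sy sz yze.
have inS1 : inS e.1 by apply/forall_inP => s /heS/on_edge_source.
have inS2 : inS (target e) by apply/forall_inP => s /heS/on_edge_target.
case/orP: (hab e yze (heS _ cS)) => he; last first.
  by rewrite (on_edge_source he) (on_edge_target he).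
have := no e.1; have := no (target e).
rewrite inS1 inS2 (on_edge_source he) (on_edge_target he) /=.
by move=> /negbTE -> /negbTE ->.
Qed.

(** Induction on the size: omitting [a], [b], [c] in turn gives vertices [ya], [yb], [yc]. An edge
    crossed oddly between [ya] and [yb] is so between [ya] and [yc], hence on the coset of [b], or
    between [yc] and [yb], hence on that of [a]. So [bridge] applies to [S] without [a] and [b]. *)
Lemma helly (S : {set T}) : S != set0 ->
  {in S &, forall s t, joint p [set s; t]} -> joint p S.
Proof.
have [m] := ubnP #|S|; elim: m S => // m IH S Sm S0 cl.
case/set0Pn: S0 => a aS.
have [/eqP|/set0Pn[b]] := boolP (S :\ a == set0).
  move/setP => S1; suff -> : S = [set a] by apply: joint1.
  apply/setP => s; rewrite !inE; have := S1 s; rewrite !inE.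
  by case: (eqVneq s a) => [->|_]; rewrite ?aS.
rewrite !inE => /andP[ba bS].
have [/eqP|/set0Pn[c]] := boolP (S :\ a :\ b == set0).
  move/setP => S1; suff -> : S = [set a; b] by exact: (cl a b).
  apply/setP => s; rewrite !inE; have := S1 s; rewrite !inE.
  case: (eqVneq s a) => [->|_]; rewrite ?aS //.
  by case: (eqVneq s b) => [->|_]; rewrite ?bS.
rewrite !inE => /and3P[cb ca cS].
have sub d : d \in S -> forall d', d' \in S -> d' != d ->
    exists y, forall s, s \in S -> s != d -> on (p s) y.
  move=> dS d' d'S d'd; have /jointP[y hy] : joint p (S :\ d).
    apply: IH.
    - by move: Sm; rewrite (cardsD1 d S) dS.
    - by apply/set0Pn; exists d'; rewrite !inE d'd.
    - by move=> s t /setD1P[_ sS] /setD1P[_ tS]; apply: cl.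
  by exists y => s sS sd; apply: hy; rewrite !inE sd.
have [ya hya] := sub a aS b bS ba.
have [yb hyb] := sub b bS c cS cb.
have ac : a != c by rewrite eq_sym.
have [yc hyc] := sub c cS a aS ac.
apply: (@joint_sub _ _ _ (a |: (b |: (S :\ a :\ b)))).
  apply/subsetP => s sS; rewrite !inE sS andbT.
  by case: (s == a) => //; case: (s == b).
have ab : a != b by rewrite eq_sym.
have bc : b != c by rewrite eq_sym.
apply: (@bridge _ _ _ c ya yb).
- by rewrite !inE cb ca.
- by move=> s; rewrite !inE => /and3P[sb sa sS]; split; [apply: hya|apply: hyb].
- exact: hya.
- exact: hyb.
- move=> e /(diff_trans yc) /orP[] d _; apply/orP.
    by right; apply: diff_on (hya _ bS ba) (hyc _ bS bc) d.
  by left; apply: diff_on (hyc _ aS ac) (hyb _ aS ab) d.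
Qed.

(** Each coset is sent to the class of its state at the common vertex [y0], paired with 1. For
    another vertex [z], the property [D] holds at [y0] and passes along oddly crossed edges, since
    these lie on every coset through [y0] and [z]; so [cut_invariant] carries it to [z]. *)
Lemma solvable_simplex (U : {set T}) : joint p U -> solvable_on p U.
Proof.
case/jointP=> y0 hy0.
pose x0 s := odflt (p s).1 [pick x | conn (p s) (x, y0)].
have hx0 s : s \in U -> conn (p s) (x0 s, y0).
  move/hy0/existsP=> [x px]; rewrite /x0; case: pickP => //= /(_ x).
  by rewrite px.
exists (fun s => (x0 s, 1)) => z.
pose S := [set s in U | on (p s) z].
(* Some coset through [z] is needed to supply a path from [y0]; if there is none, any [f] works. *)
have [S0|/set0Pn[c cS]] := eqVneq S set0.
  exists 1 => s x sU px; have: s \in S.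
    by rewrite inE sU; apply/existsP; exists x.
  by rewrite S0 inE.
pose D (y : Y) := `[< exists f : F, forall s, s \in S ->
  exists2 x, conn (proj (p s)) (x, y) & ThetaF (x0 s, 1) (x, f) >].
have: D z.1.
  have [cU /existsP[x cz]] := setIdP cS.
  have yz : conn (x0 c, y0) (x, z).
    by apply: connect_trans cz; rewrite -/(conn _ _) conn_sym hx0.
  rewrite -(cut_invariant (D := D) yz) => [|e /= d]; last first.
    have he s : s \in S -> exists x x', [/\ conn (proj (p s)) (x, e.1),
        conn (proj (p s)) (x', target e) & edge (e.2, false) x x'].
      case/setIdP=> sU sz; apply/on_edgeP; apply: diff_on sz d.
      exact: hy0.
    apply/asboolP/asboolP => -[f hf].
      exists ((lval (@fgen (symbol A)) (e.2, false))^-1 * f) => s sS.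
      have [x1 [x2 [h1 h2 ex]]] := he s sS; exists x2 => //.
      have [x3 h3 th] := hf s sS.
      rewrite (faithful_state fY h3 h1) in th.
      apply: Theta_trans th _.
      rewrite -{1}[f](mulKVg (lval (@fgen (symbol A)) (e.2, false))).
      exact: ThetaF_edge.
    exists (lval (@fgen (symbol A)) (e.2, false) * f) => s sS.
    have [x1 [x2 [h1 h2 ex]]] := he s sS; exists x1 => //.
    have [x3 h3 th] := hf s sS.
    rewrite (faithful_state fY h3 h2) in th.
    by apply: Theta_trans th _; apply: Theta_sym; apply: ThetaF_edge.
  apply/asboolP; exists 1 => s /setIdP[sU _]; exists (x0 s).
    exact: (conn_proj (hx0 s sU)).
  exact: Theta_refl.
case/asboolP=> f hf; exists f => s x sU px.
have sS : s \in S by rewrite inE sU; apply/existsP; exists x.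
have [x1 h1 th] := hf s sS.
by have <- : x1 = x := faithful_state fY h1 (conn_proj px).
Qed.

(** Right translation by [f1^-1 * f2] makes the first solution agree with the second on [C], because
    it does so at [y0]. At a vertex on a coset of [K], all members of [V] present lie in [C], so the
    translated first solution serves; elsewhere the second does. *)
Lemma solvable_glue (K C V : {set T}) : joint p C ->
  (forall s t, s \in K -> t \in V -> joint p [set s; t] -> t \in C) ->
  C \subset V -> solvable_on p (K :|: C) -> solvable_on p V ->
  solvable_on p (K :|: V).
Proof.
case/jointP=> y0 hy0 sep CV [q1 h1] [q2 h2].
have [f1 hf1] := h1 y0; have [f2 hf2] := h2 y0.
pose q1' s := ((q1 s).1, (q1 s).2 * (f1^-1 * f2)).
have tr s x f : ThetaF (q1 s) (x, f) -> ThetaF (q1' s) (x, f * (f1^-1 * f2)).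
  by rewrite {1}[q1 s]surjective_pairing => /ThetaF_mulr; apply.
have qC s : s \in C -> ThetaF (q2 s) (q1' s).
  move=> sC; have /existsP[x px] := hy0 s sC.
  have th2 := hf2 s x (subsetP CV _ sC) px.
  have sKC : s \in K :|: C by rewrite inE sC orbT.
  have /tr := hf1 s x sKC px; rewrite mulKVg => th1.
  exact: Theta_trans th2 (Theta_sym th1).
exists (fun s => if s \in K then q1' s else q2 s) => z.
have [/existsP[k /andP[kK kz]]|/existsPn noK] :=
    boolP [exists k, (k \in K) && on (p k) z]; last first.
  have [f hf] := h2 z; exists f => s x; case: ifP => sK.
    move=> _ px; case/negP: (noK s); rewrite sK; apply/existsP; by exists x.
  by rewrite inE sK; apply: hf.
have [f hf] := h1 z; exists (f * (f1^-1 * f2)) => s x; case: ifP => sK.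
  by move=> _ px; apply/tr/hf => //; rewrite inE sK.
rewrite inE sK => /= sV px.
have sC : s \in C.
  apply: sep kK sV _; apply/jointP; exists z => _ /set2P[] -> //.
  by apply/existsP; exists x.
apply: Theta_trans (qC s sC) _; apply/tr/hf => //; by rewrite inE sC orbT.
Qed.

(** If [U] is not joint, [helly] yields [s] and [t] whose cosets do not meet. [K] is the component
    of [t] among the members not meeting [s], and its boundary [C] is joint. Gluing along [C]
    reduces to [K :|: C], which omits [s], and [U :\: K], which omits [t]. *)
Lemma solvable_stable (U : {set T}) : solvable_on p U.
Proof.
have [m] := ubnP #|U|; elim: m U => // m IH U; rewrite ltnS => Um.
case: (boolP (joint p U)) => [|UN]; first exact: solvable_simplex.
have [U0|Un0] := eqVneq U set0.
  by exists (fun s => ((p s).1, 1)) => y; exists 1 => s x; rewrite U0 inE.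
have /existsP[s /existsP[t /and3P[sU tU st]]] : [exists s, [exists t,
    [&& s \in U, t \in U & ~~ joint p [set s; t]]]].
  apply: contraR UN => /existsPn no; apply: helly => // s t sU tU.
  apply: contraT => st; case/existsP: (no s); exists t.
  by rewrite sU tU st.
pose adj k l := joint p [set k; l].
have adjC k l : adj k l = adj l k by rewrite /adj setUC.
pose far k := (k \in U) && ~~ adj s k.
pose link k l := adj k l && far l.
pose K := [set k | connect link t k].
pose C := [set u in U | (u \notin K) && [exists k in K, adj k u]].
have far_t : far t by rewrite /far tU.
have farK k : k \in K -> far k.
  rewrite inE => /connectP[r]; elim/last_ind: r => [|r k' _] /=.
    by move=> _ ->.
  by rewrite rcons_path last_rcons => /andP[_ /andP[_ fk]] ->.
have sepC k u : k \in K -> u \in U -> u \notin K -> adj k u -> u \in C.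
  move=> kK uU uK ku; rewrite inE uU uK; apply/existsP; exists k.
  by rewrite kK.
have adjs u : u \in C -> adj s u.
  rewrite inE => /and3P[uU uK /existsP[k /andP[kK ku]]]; apply: contraR uK.
  move=> su; rewrite inE; apply: (@connect_trans _ _ k).
    by rewrite inE in kK.
  by apply: connect1; rewrite /link ku /far uU.
have adjK u : u \in C -> exists2 k, k \in K & adj k u.
  by rewrite inE => /and3P[_ _ /existsP[k /andP[kK ku]]]; exists k.
have sK : s \notin K.
  apply/negP => /farK /andP[_]; rewrite /adj setUid.
  by rewrite joint1.
have tK : t \in K by rewrite inE connect0.
have ont : on (p t) (p t).2.
  apply/existsP; exists (p t).1.
  by rewrite -surjective_pairing; apply: connect0.
have farE k e : far k -> on_edge (proj (p s)) e -> ~~ on_edge (proj (p k)) e.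
  case/andP=> _ sk es; apply: contra sk => ek; rewrite /adj.
  apply/stable/jointP; exists e.1 => _ /set2P[] ->; exact: on_edge_source.
(* By stability the cosets in K do not meet that of s even over Y, so the
   edges crossed oddly along a chain of cosets in K are not edges of s. *)
have chain k z e : k \in K -> on (p k) z -> on_edge (proj (p s)) e ->
    ~~ diff (p t).2 z e.
  move=> + + es; rewrite inE => /connectP[r].
  elim/last_ind: r k z => [|r k' IHr] k z /=.
    by move=> _ -> tz; apply: contra (farE _ _ far_t es); apply: diff_on.
  rewrite rcons_path last_rcons => /andP[tr /andP[+ fk]] -> kz.
  case/jointP=> y hy; have yl := hy _ (set21 _ _); have yk := hy _ (set22 _ _).
  apply/negP => /(diff_trans y) /orP[]; apply/negP.
    exact: IHr tr erefl yl.
  by apply: contra (farE _ _ fk es); apply: diff_on.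
have CU : C \subset U by apply/subsetP => u /setIdP[].
have CN : joint p C.
  have [->|C0] := eqVneq C set0.
    by apply: joint_sub (joint1 p t); apply: sub0set.
  apply: helly => // u v uC vC.
  have /jointP[yu hyu] := adjs u uC; have /jointP[yv hyv] := adjs v vC.
  (* Both [u] and [v] meet [s] and also meet [K]. Going from [yu] to [yv] through [K], the middle
     stretch crosses no edge of [s] oddly, so any such edge comes from the coset of [u] or of
     [v]. *)
  suff: joint p (v |: (u |: [set s])).
    apply: joint_sub; apply/subsetP => w /set2P[] ->.
      by rewrite !inE eqxx orbT.
    by rewrite !inE eqxx.
  apply: (@bridge _ _ _ s yu yv); rewrite ?inE //.
  - by move=> w /set1P ->; split; [apply: hyu|apply: hyv]; rewrite set21.
  - by apply: hyu; rewrite set22.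
  - by apply: hyv; rewrite set22.
  move=> e yuv es; apply/orP.
  have [k kK /jointP[zu hzu]] := adjK u uC.
  have [k' kK' /jointP[zv hzv]] := adjK v vC.
  case/orP: (diff_trans zu yuv) => [d|d].
    right; apply: diff_on d; [apply: hyu|apply: hzu]; exact: set22.
  case/orP: (diff_trans zv d) => [{}d|{}d]; last first.
    left; apply: diff_on d; [apply: hzv|apply: hyv]; exact: set22.
  have := chain k zu e kK (hzu _ (set21 _ _)) es.
  have := chain k' zv e kK' (hzv _ (set21 _ _)) es.
  by move: d; rewrite /diff; case: (zu.2 e) (zv.2 e) ((p t).2.2 e) => [] [] [].
have KU : K \subset U by apply/subsetP => k /farK /andP[].
have -> : U = K :|: (U :\: K) by rewrite -{1}(setID U K) (setIidPr KU).
apply: (@solvable_glue K C) => //.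
- move=> k u kK /setDP[uU uK]; exact: sepC.
- apply/subsetP => u uC; rewrite inE (subsetP CU) // andbT.
  by move: uC; rewrite inE => /and3P[].
- apply: IH; apply: leq_trans Um; apply: proper_card; apply/properP; split.
    by rewrite subUset KU.
  exists s => //; rewrite inE (negbTE sK) /=; apply/negP.
  rewrite inE => /and3P[_ _ /existsP[k /andP[/farK /andP[_ /negP sk]]]].
  by rewrite adjC.
- apply: IH; apply: leq_trans Um; apply: proper_card; apply/properP; split.
    exact: subsetDl.
  by exists t => //; rewrite inE tK.
Qed.

End Stable.

(** * Iterated unfoldings and the growth of nerves *)

Definition nerve (Y : automaton) (p : T -> X * Y) := [set S | joint p S].

Fixpoint tower (Y : automaton) k :=
  if k is k'.+1 then unfolding (tower Y k') else Y.

Lemma tower_faithful (Y : automaton) k : faithful Y -> faithful (tower Y k).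
Proof. by move=> fY; elim: k => //= k; apply: unfold_faithful. Qed.

(* Each passage to a lower level either enlarges the nerve or, when the nerve is
   unchanged, yields a solution; the nerve has at most [2 ^ #|T|] members. *)
Lemma tower_solvable (Y : automaton) k (p : T -> X * tower Y k) : faithful Y ->
  solvable_on p setT \/ k + #|nerve p| <= 2 ^ #|T|.
Proof.
move=> fY; elim: k p => [|k IH] p /=.
  right; rewrite -cardsT -card_powerset; apply: subset_leq_card.
  by apply/subsetP => S _; rewrite powersetE subsetT.
have sub : nerve p \subset nerve (@proj _ \o p).
  by apply/subsetP => S; rewrite !inE; apply: joint_proj.
have [/subsetP eqN|neN] := boolP (nerve (@proj _ \o p) \subset nerve p).
  left; apply: solvable_stable; first exact: tower_faithful.
  by move=> S jS; have := eqN S; rewrite !inE; apply.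
case: (IH (@proj _ \o p)) => [/solvable_proj|le]; first by left.
right; apply: leq_trans le; rewrite addSnnS leq_add2l; apply: proper_card.
by rewrite properE sub.
Qed.

(** At this height the numerical alternative leaves an empty nerve; singletons being joint, [T] is
    then empty. *)
Lemma solvable_tower (Y : automaton) (p : T -> X * tower Y (2 ^ #|T|)) :
  faithful Y -> solvable_on p setT.
Proof.
move=> fY; case: (tower_solvable p fY) => //.
rewrite -[X in _ <= X]addn0 leq_add2l leqn0 => /eqP/cards0_eq N0.
exists (fun s => ((p s).1, 1)) => y; exists 1 => s.
by have := joint1 p s; rewrite -[joint _ _]in_set -/(nerve p) N0 inE.
Qed.

End Patterns.

(** On permutations of X under right multiplication by extensions of the letters, [(p.2)^-1 p.1] is
    constant along a coset, so the vertex determines the state. *)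
Lemma base_automaton : exists2 Y : automaton, faithful Y & inhabited Y.
Proof.
have /choice[ext extP] (a : symbol A) :
    exists s : {perm X}, forall x y, papply a x = Some y -> s x = y.
  exact/pinj_extends_perm/(valP (val a)).
pose actp (l : letter (symbol A)) (s : {perm X}) := s * lval ext l.
have actpK l : cancel (actp l) (actp (linv l)).
  by move=> s; rewrite /actp lval_linv mulgK.
exists (Automaton actpK); last exact: (inhabits (1 : {perm X})).
have track : forall p q : X * Automaton actpK, conn p q ->
    (p.2 : {perm X})^-1 p.1 = (q.2 : {perm X})^-1 q.1.
  move=> p q; elim/conn_ind => // {}p {}q r l e <- _ <-.
  rewrite /= /actp invMg permM; congr (_ _).
  apply: (@perm_inj _ (lval ext l)); rewrite permKV.
  case: l e => a [] /= /eqP /extP; rewrite /lval /= => <- //.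
  by rewrite permK.
by move=> x x' y /track /= /perm_inj.
Qed.

(** * From a finite automaton to a finite permutation group *)

Section Realization.
Variables (Y : automaton) (y0 : Y).

Definition act_perm (a : symbol A) : {perm Y} :=
  perm (can_inj (@actK Y (a, false))).

Lemma act_permE l y : lval act_perm l y = act l y.
Proof.
case: l => a []; rewrite /lval /=; last by rewrite permE.
by apply: (@perm_inj _ (act_perm a)); rewrite permKV permE (actK (a, true)).
Qed.

Definition act_group := <<[set act_perm a | a : symbol A]>>%G.

Lemma act_perm_in a : act_perm a \in act_group.
Proof. by apply/mem_gen/imsetP; exists a. Qed.

Definition act_gen a : subg_of act_group := Subg (act_perm_in a).

Lemma act_gen_generates : <<[set act_gen a | a : symbol A]>> = setT.
Proof.
apply: (injm_morphim_inj (injm_sgval act_group)); rewrite ?subsetT //.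
rewrite im_sgval morphim_gen ?subsetT // morphimEsub ?subsetT //.
by rewrite -imset_comp.
Qed.

(* As letters act on the right of [XP] and of [Y], the element [g] of the group
   corresponds to the vertex [y0 * g^-1]. *)
Lemma Theta_conn p q : Theta act_gen p q ->
  conn (p.1, (sgval p.2)^-1 y0) (q.1, (sgval q.2)^-1 y0).
Proof.
have sgvalV l : sgval (lval act_gen l) = lval act_perm l.
  by case: l => a [] //; rewrite /lval /= morphV ?in_setT.
(* The base vertex is generalised because multiplication by a letter shifts it. *)
move=> th; elim: th y0 => {p q}.
- by move=> p y; apply: connect0.
- by move=> p q _ IH y; rewrite conn_sym.
- by move=> p q r _ IH _ IH' y; apply: connect_trans (IH y) (IH' y).
- move=> x y g h l _ IH z /=.
  by rewrite sgvalV !invMg !permM; apply: IH.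
move=> l x y e z /=; rewrite sgvalV invg1 perm1.
apply: connect1; apply/existsP; exists l.
by rewrite e -act_permE permKV eqxx.
Qed.

End Realization.

End Automata.

Theorem proposition4p16 (X : finType) (A : {set pbij X}) (n : nat) (n_gt0 : 0 < n) :
  exists (G : finGroupType) (v : symbol A -> G),
    << [set v a | a : symbol A] >>%g = [set: G] /\
    forall g : 'I_n -> G, exists f : 'I_n -> freeGroup (symbol A),
      partial_function (fun p : XP v * XP (@fgen (symbol A)) =>
        exists (x : X) (i : 'I_n),
          p = (xp v x (g i), xp (@fgen (symbol A)) x (f i))).
Proof.
have [Y0 fY0 [y00]] := base_automaton A.
(* One coset for each pair of a point and an index; the height depends only on their number, so the
   group is fixed before [g]. *)
pose Y := tower Y0 (2 ^ #|{: X * 'I_n}|).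
have [y0] : inhabited Y.
  rewrite /Y; elim: (2 ^ _)%N => [|k [y]] /=; first exact: (inhabits y00).
  exact: (inhabits ((y, [ffun=> false]) : unfolding _)).
exists (subg_of (act_group Y)), (@act_gen _ _ Y).
split=> [|g]; first exact: act_gen_generates.
pose y i := (sgval (g i))^-1 y0.
have [q hq] :=
  solvable_tower (fun s : X * 'I_n => (s.1, y s.2) : X * Y) fY0.
have /choice[f hf] i := hq (y i).
exists f => _ _ [x [i ->]] [x' [j ->]] /= /xp_eq/(Theta_conn y0) /= xx'.
(* The coset of [(x, y i)] passes through [(x', y j)], so both sides equal the class of
   [q (x, i)]. *)
apply/xp_eq; apply: (@Theta_trans _ _ _ _ _ (q (x, i))).
  by apply/Theta_sym/hf; rewrite ?inE //; apply: connect0.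
by apply: hf; rewrite ?inE.
Qed.
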